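(* Let $\mathcal{G}$ be a ring of $n$ cells with energy function $$h(\theta)=\sum_{i=1}^n\delta(\theta_i-\theta_{i-1}),\qquad \theta_0=\theta_n,$$ where the coupling function $\delta:\mathbb{R}\to\mathbb{R}$ is smooth and satisfies: $\delta$ is even and 1-periodic; the first derivative $\delta'$ vanishes (modulo 1) only at $0$ and $1/2$; the second derivative $\delta''$ is monotone in the interval $(0,1/2)$; and $\delta''(0)<0$, $\delta''(1/2)>0$. Then the stability of the equilibria of $\dot\theta=-\nabla h(\theta)$ is as follows: (1) For $n$ even, an equilibrium with $\mathbf{Z}_n(\tau,1/2)$-isotropy is stable. (2) For an integer $m$ with $0\le m\le n/2$ and $m\neq 0,n/2$, an equilibrium with $\mathbf{Z}_n(\tau,m/n)$-isotropy is stable if and only if $\delta''(m/n)>0$. (3) For $n$ odd, a trivial isotropy equilibrium $\theta=(\theta_1,\dots,\theta_n)$ with $\theta_i\in\{0,1/2\}$ is stable only if at most one pair of neighbours assume the same state value. (4) Possible trivial isotropy equilibria with $\xi,\eta$ in the open interval $(0,1/2)$ are stable only if $p=n-1$, $q=1$.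
   Context: A ring of $n$ cells is the graph given by a regular $n$-sided polygon. Here $\mathbf{S}^1\equiv[0,1]$ with endpoints identified (i.e. $\mathbb{R}/\mathbb{Z}$), and $\theta=(\theta_1,\dots,\theta_n)$ with indices read modulo $n$ ($\theta_{n+1}=\theta_1$); cells $i$ and $i+1$ are neighbours. The group $\mathbf{D}_n\times\mathbf{S}^1$ (with $\mathbf{D}_n$ the dihedral group of permutations preserving the ring) acts on the torus $(\mathbf{S}^1)^n$ by $(\pi,\varphi)\cdot(\theta_1,\dots,\theta_n)=(\theta_{\pi^{-1}(1)}+\varphi,\dots,\theta_{\pi^{-1}(n)}+\varphi)$ and leaves $h$ invariant. The differences $x_i=\theta_{i+1}-\theta_i$ are taken in $[0,1/2]$ with $\sum_{i=1}^n x_i=m\in\mathbb{Z}$, $0\le m\le n/2$. - An equilibrium with $\mathbf{Z}_n(\tau,m/n)$-isotropy (where $\tau$ is the cyclic permutation $i\mapsto i+1$) is one with $\theta_{i+1}-\theta_i=m/n$ (mod 1) for all $i=1,\dots,n$. - A trivial isotropy equilibrium is a point $\theta$ for which there are $0\le\eta<\xi\le 1/2$ with $\delta'(\xi)=\delta'(\eta)$ and positive integers $p,q$ with $p+q=n$ such that $p$ of the differences $\theta_{i+1}-\theta_i$ ($1\le i\le n$) equal $\xi$ and the other $q$ equal $\eta$ (mod 1), and $p\xi+q\eta=m$ is an integer with $0\le m\le n/2$. The Hessian of $h$ at any point is a weighted graph Laplacian, so its kernel is at least one-dimensional. An equilibrium is called (asymptotically) stable if all nonzero eigenvalues of the Hessian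 of $h$ at this point are positive.
   Formalization: ''Stable'' is taken to mean that the kernel of the Hessian is exactly one-dimensional and all nonzero eigenvalues are positive; without the kernel condition (2) fails when δ''(m/n)=0, since the Hessian then vanishes. *)

(* Defs.v *)
From HB Require Import structures.
From mathcomp Require Export all_boot all_order all_algebra.
From mathcomp Require Export all_classical all_reals all_analysis.
Export Order.TTheory GRing.Theory Num.Theory.
Export numFieldNormedType.Exports.

Set Implicit Arguments.
Unset Strict Implicit.
Unset Printing Implicit Defensive.

Local Open Scope ring_scope.
Local Open Scope classical_set_scope.

(* Equality in S^1 = R/Z of the classes of two reals. A point of the torus
   (S^1)^n is represented below by a lift theta : 'rV[R]_n; every predicate on
   theta is invariant under integer translations of its entries when the
   coupling function is 1-periodic. *)
Definition eq_mod1 (R : realType) (x y : R) : bool := x - y \is a Num.int.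

Record coupling_function (R : realType) (delta : R -> R) : Prop :=
  CouplingFunction {
    coupling_smooth : forall (k : nat) (x : R), derivable (delta^`(k)) x 1 ;
    coupling_even : forall x : R, delta (- x) = delta x ;
    coupling_periodic : forall x : R, delta (x + 1) = delta x ;
    coupling_deriv_zeros : forall x : R, delta^`() x = 0 ->
      eq_mod1 x 0 \/ eq_mod1 x (1 / 2) ;
    (* weak monotonicity, in either direction *)
    coupling_deriv2_monotone :
      (forall x y : R, 0 < x -> x <= y -> y < 1 / 2 ->
         delta^`(2) x <= delta^`(2) y) \/
      (forall x y : R, 0 < x -> x <= y -> y < 1 / 2 ->
         delta^`(2) y <= delta^`(2) x) ;
    coupling_deriv2_0 : delta^`(2) 0 < 0 ;
    coupling_deriv2_half : 0 < delta^`(2) (1 / 2)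
  }.

Definition energy (R : realType) (n : nat) (delta : R -> R) (theta : 'rV[R]_n)
    : R :=
  \sum_(i < n) delta (theta 0 i - theta 0 (ord_pred i)).

Definition partial (R : realType) (n : nat) (f : 'rV[R]_n -> R) (i : 'I_n)
    (theta : 'rV[R]_n) : R :=
  'D_('e_i : 'rV[R]_n) f theta.

Definition grad (R : realType) (n : nat) (f : 'rV[R]_n -> R)
    (theta : 'rV[R]_n) : 'rV[R]_n :=
  \row_i partial f i theta.

Definition hessian (R : realType) (n : nat) (f : 'rV[R]_n -> R)
    (theta : 'rV[R]_n) : 'M[R]_n :=
  \matrix_(i, j) partial (partial f j) i theta.

(* Zeros of the vector field of theta' = - grad h(theta). *)
Definition equilibrium (R : realType) (n : nat) (h : 'rV[R]_n -> R)
    (theta : 'rV[R]_n) : Prop :=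
  - grad h theta = 0.

(* The eigenvalue 0 along the S^1-orbit is forced and is the only one that is
   discarded: without the first clause a point with vanishing Hessian would
   count as stable. *)
Definition stable (R : realType) (n : nat) (h : 'rV[R]_n -> R)
    (theta : 'rV[R]_n) : Prop :=
  \rank (kermx (hessian h theta)) = 1%N /\
  (forall a : R, eigenvalue (hessian h theta) a -> a != 0 -> 0 < a).

(* theta_(i+1) - theta_i, with indices modulo n *)
Definition ring_diff (R : realType) (n : nat) (theta : 'rV[R]_n) (i : 'I_n)
    : R :=
  theta 0 (ordS i) - theta 0 i.

(* An equilibrium with Z_n(tau, phi)-isotropy. *)
Definition Zn_isotropy_equilibrium (R : realType) (n : nat) (delta : R -> R)
    (phi : R) (theta : 'rV[R]_n) : Prop :=
  equilibrium (energy delta) theta /\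
  (forall i : 'I_n, eq_mod1 (ring_diff theta i) phi).

Record trivial_isotropy_equilibrium (R : realType) (n : nat) (delta : R -> R)
    (xi eta : R) (p q : nat) (theta : 'rV[R]_n) : Prop :=
  TrivialIsotropyEquilibrium {
    ti_eta_ge0 : 0 <= eta ;
    ti_eta_lt_xi : eta < xi ;
    ti_xi_le_half : xi <= 1 / 2 ;
    ti_deriv_eq : delta^`() xi = delta^`() eta ;
    ti_p_gt0 : (0 < p)%N ;
    ti_q_gt0 : (0 < q)%N ;
    ti_pq : (p + q = n)%N ;
    ti_card_xi : #|[set i : 'I_n | eq_mod1 (ring_diff theta i) xi]%SET| = p ;
    ti_card_eta : #|[set i : 'I_n | eq_mod1 (ring_diff theta i) eta]%SET| = q ;
    ti_sum : exists m : nat,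
      (m.*2 <= n)%N /\ xi *+ p + eta *+ q = m%:R
  }.

(* For n >= 3 the pairs of neighbours {i, i+1} are indexed bijectively by i. *)
Definition equal_neighbours (R : realType) (n : nat) (theta : 'rV[R]_n)
    : {set 'I_n} :=
  [set i : 'I_n | eq_mod1 (theta 0 (ordS i)) (theta 0 i)]%SET.

(* Main.v *)
Require Import Defs.
From mathcomp Require Import ring lra zify.

(** The Hessian of the energy at theta is the Laplacian of the ring in which
    the edge joining the cells k - 1 and k has weight
    c_k = delta''(theta_k - theta_(k-1)): its quadratic form is
    sum_k c_k (v_k - v_(k-1))^2 ([hessian_energy], [qform_ring_laplacian]).

    If every c_k is positive, this form is nonnegative and vanishes only on the
    constant vectors, so the point is stable ([ring_laplacian_stable]).

    Conversely, a stable point has at most one edge of nonpositive weight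
    ([stable_nonpos_weight_unique]).  Stability makes the form positive on every
    nonconstant vector: the minimum of the form on the unit sphere is attained
    at an eigenvector, so a symmetric matrix without negative eigenvalues has a
    nonnegative form ([symmetric_min_eigenvalue]), and the isotropic vectors of
    such a form lie in the kernel ([psd_isotropic]), which here is the line of
    constant vectors.  Two edges cut the ring into two arcs, and the form of the
    indicator vector of an arc is the sum of the weights of these two edges, so
    they cannot both be nonpositive.

    The four claims follow by finding the sign of the weights, which depend only
    on the differences modulo 1.  At a point with all differences equal to phi,
    all weights are delta''(phi), and the ring has at least two edges.  Between
    two neighbours in the same state the weight is delta''(0) < 0.  Finally, as
    delta'' is monotone with delta''(0) < 0 < delta''(1/2), it is nondecreasing;
    if delta'(xi) = delta'(eta) with 0 < eta < xi < 1/2, the mean value theorem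
    gives a zero of delta'' between them, whence delta''(eta) <= 0
    ([coupling_deriv2_le0]) and at most one difference equals eta. *)

Set Implicit Arguments.
Unset Strict Implicit.
Unset Printing Implicit Defensive.

Local Open Scope ring_scope.
Local Open Scope classical_set_scope.

(** * Quadratic forms of symmetric matrices *)

Definition qform (R : realFieldType) n (A : 'M[R]_n) (v : 'rV[R]_n) : R :=
  (v *m A *m v^T) 0 0.

Lemma sqnorm_sum (R : realFieldType) n (v : 'rV[R]_n) :
  qform 1%:M v = \sum_i v 0 i ^+ 2.
Proof.
by rewrite /qform mulmx1 mxE; apply: eq_bigr => i _; rewrite mxE expr2.
Qed.

Lemma sqnorm_ge0 (R : realFieldType) n (v : 'rV[R]_n) : 0 <= qform 1%:M v.
Proof. by rewrite sqnorm_sum sumr_ge0 // => i _; exact: sqr_ge0. Qed.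

Lemma sqnorm_eq0 (R : realFieldType) n (v : 'rV[R]_n) :
  qform 1%:M v = 0 -> v = 0.
Proof.
rewrite sqnorm_sum => v0; apply/rowP => i; rewrite mxE; apply/eqP.
rewrite -sqrf_eq0; apply/eqP; apply: (psumr_eq0P _ v0) => // k _.
exact: sqr_ge0.
Qed.

Lemma qformZ (R : realFieldType) n (A : 'M[R]_n) a (v : 'rV[R]_n) :
  qform A (a *: v) = a ^+ 2 * qform A v.
Proof. by rewrite /qform linearZ /= -scalemxAr -!scalemxAl !mxE mulrA. Qed.

Lemma qform_sub_scalar (R : realFieldType) n (A : 'M[R]_n) a (v : 'rV[R]_n) :
  qform (A - a%:M) v = qform A v - a * qform 1%:M v.
Proof.
by rewrite /qform mulmxBr mulmxBl mul_mx_scalar mulmx1 -scalemxAl !mxE.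
Qed.

(** Put w := v A.  Along the line v - s w the form equals s^2 Q - 2 s N, with
    N the squared norm of w and Q its form; it would be negative for small
    s > 0 if N were positive. *)
Lemma psd_isotropic (R : realFieldType) n (A : 'M[R]_n) (v : 'rV[R]_n) :
  A^T = A -> (forall u, 0 <= qform A u) -> qform A v = 0 -> v *m A = 0.
Proof.
move=> symA psdA v0; set w := v *m A; apply: sqnorm_eq0.
set N := qform 1%:M w; set Q := qform A w.
have E s : qform A (v - s *: w) = s ^+ 2 * Q - 2 * s * N.
  have vw : (v *m A *m w^T) 0 0 = N by rewrite -/w /N /qform mulmx1.
  have wv : (w *m A *m v^T) 0 0 = N.
    have -> : w *m A *m v^T = (v *m A *m w^T)^T.
      by rewrite trmx_mul trmxK trmx_mul symA mulmxA.
    by rewrite mxE.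
  rewrite /qform mulmxBl linearB /= !mulmxBr !mulmxBl linearZ /=.
  rewrite -!scalemxAr -!scalemxAl -?scalemxAr.
  have mxBB (M1 M2 M3 M4 : 'M[R]_1) : (M1 - M2 - (M3 - M4)) 0 0 =
     M1 0 0 - M2 0 0 - M3 0 0 + M4 0 0 by rewrite !mxE; ring.
  rewrite mxBB -/(qform A v) v0.
  have scE c (M : 'M[R]_1) : (c *: M) 0 0 = c * M 0 0 by rewrite mxE.
  rewrite !scE vw wv -/(qform A w) -/Q; ring.
have Q0 : 0 <= Q by exact: psdA.
(* N / (Q + 1) makes s^2 Q - 2 s N equal to - s^2 (Q + 2), also when Q = 0. *)
have := psdA (v - (N / (Q + 1)) *: w); rewrite E.
have -> : (N / (Q + 1)) ^+ 2 * Q - 2 * (N / (Q + 1)) * N =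
    - (N / (Q + 1)) ^+ 2 * (Q + 2).
  by field; rewrite gt_eqF // ltr_wpDl.
rewrite mulNr oppr_ge0 pmulr_lle0 ?ltr_wpDl //.
move=> le0; have /eqP : (N / (Q + 1)) ^+ 2 == 0.
  by rewrite eq_le le0 sqr_ge0.
move/eqP; rewrite sqrf_eq0 mulf_eq0 invr_eq0 [Q + 1 == 0]gt_eqF ?ltr_wpDl //.
by rewrite orbF => /eqP.
Qed.

Lemma qform_continuous (R : realType) n (A : 'M[R]_n) : continuous (qform A).
Proof.
have -> : qform A =
    fun v : 'rV[R]_n => \sum_j (\sum_i v 0 i * A i j) * v 0 j.
  by apply/funext => v; rewrite /qform mxE; apply: eq_bigr => j _; rewrite !mxE.
have cD : continuous (fun x : R * R => x.1 + x.2) by exact: add_continuous.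
move=> v; apply: (@cvg_big _ _ _ _ _ cD _ _ _ _ _ (nbhs_filter v)) => j _.
apply: cvgM; last exact: coord_continuous.
apply: (@cvg_big _ _ _ _ _ cD _ _ _ _ _ (nbhs_filter v)) => i _.
by apply: cvgM; [exact: coord_continuous | exact: cvg_cst].
Qed.

(** Let v minimize the form on the unit sphere, with value a.  Then the form of
    A - a is nonnegative and vanishes at v, so that v (A - a) = 0. *)
Lemma symmetric_min_eigenvalue (R : realType) n (A : 'M[R]_n.+1) :
  A^T = A ->
  exists2 a, eigenvalue A a & forall v, a * qform 1%:M v <= qform A v.
Proof.
move=> symA.
pose S := [set v : 'rV[R]_n.+1 | qform 1%:M v = 1].
have Scompact : compact S.
  have cube :=
    @rV_compact R n.+1 (fun=> `[-1, 1]) (fun=> @segment_compact R _ _).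
  apply: subclosed_compact cube _.
    apply: (preimage_closed _ (@closed_eq R 1)) => v _.
    exact: qform_continuous.
  move=> v /= v1 i; rewrite in_itv /= -ler_norml -(@ler_sqr R) ?nnegrE //.
  rewrite expr1n real_normK ?num_real // -v1 sqnorm_sum (bigD1 i) //= lerDl.
  by apply: sumr_ge0 => k _; exact: sqr_ge0.
have normalize v : qform 1%:M v != 0 -> S ((Num.sqrt (qform 1%:M v))^-1 *: v).
  move=> v0; rewrite /S /= qformZ exprVn sqr_sqrtr ?sqnorm_ge0 //.
  by rewrite mulVf.
have S0 : S !=set0.
  pose e0 : 'rV[R]_n.+1 := 'e_ord0.
  exists ((Num.sqrt (qform 1%:M e0))^-1 *: e0); apply: normalize.
  apply/eqP => /sqnorm_eq0 /rowP /(_ ord0); rewrite !mxE !eqxx.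
  by move/eqP; rewrite oner_eq0.
have [|v Sv vmin] := @compact_EVT_min _ R (qform A) S S0 Scompact.
  by apply: continuous_subspaceT => x; exact: qform_continuous.
have {}Sv : qform 1%:M v = 1 by move: Sv; rewrite inE.
have minA u : qform A v * qform 1%:M u <= qform A u.
  have [u0|un0] := eqVneq (qform 1%:M u) 0.
    by rewrite u0 (sqnorm_eq0 u0) mulr0 /qform !mul0mx mxE.
  have := vmin _ (mem_set (normalize _ un0)).
  rewrite qformZ exprVn sqr_sqrtr ?sqnorm_ge0 // mulrC ler_pdivlMr //.
  by rewrite lt_def un0 sqnorm_ge0.
exists (qform A v) => //; apply/eigenvalueP; exists v; last first.
  apply/eqP => v0; move: Sv; rewrite v0 /qform !mul0mx mxE => /esym/eqP.
  by rewrite oner_eq0.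
apply/eqP; rewrite -subr_eq0 -mul_mx_scalar -mulmxBr; apply/eqP.
apply: psd_isotropic.
- by rewrite linearB /= symA tr_scalar_mx.
- by move=> u; rewrite qform_sub_scalar subr_ge0.
- by rewrite qform_sub_scalar Sv mulr1 subrr.
Qed.

(** [stable h theta] is, by definition, this property of the Hessian. *)
Definition stable_matrix (R : realFieldType) n (A : 'M[R]_n) : Prop :=
  \rank (kermx A) = 1%N /\ (forall a, eigenvalue A a -> a != 0 -> 0 < a).

Lemma stable_matrix_psd (R : realType) n (A : 'M[R]_n.+1) v :
  A^T = A -> stable_matrix A -> 0 <= qform A v.
Proof.
move=> symA [_ eig_gt0].
have [a eig_a /(_ v)] := symmetric_min_eigenvalue symA.
apply: le_trans; have [->|a0] := eqVneq a 0; first by rewrite mul0r.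
by rewrite mulr_ge0 ?sqnorm_ge0 // ltW // eig_gt0.
Qed.

(** * The weighted Laplacian of a ring *)

(** Column k belongs to the edge joining the cells k - 1 and k. *)
Definition incidence (R : realFieldType) (n : nat) : 'M[R]_n :=
  \matrix_(i, k) ((k == i)%:R - (ord_pred k == i)%:R).

Definition ring_laplacian (R : realFieldType) n (c : 'rV[R]_n) : 'M[R]_n :=
  incidence R n *m diag_mx c *m (incidence R n)^T.

Lemma mul_incidence (R : realFieldType) n (v : 'rV[R]_n) k :
  (v *m incidence R n) 0 k = v 0 k - v 0 (ord_pred k).
Proof.
rewrite mxE.
under eq_bigr => i _ do rewrite mxE mulrBr.
rewrite sumrB (bigD1 k) //= eqxx mulr1 big1 => [|i ik]; last first.
  by rewrite eq_sym (negPf ik) mulr0.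
rewrite (bigD1 (ord_pred k)) //= eqxx mulr1 big1 => [|i ik]; last first.
  by rewrite eq_sym (negPf ik) mulr0.
by rewrite !addr0.
Qed.

Lemma qform_ring_laplacian (R : realFieldType) n (c v : 'rV[R]_n) :
  qform (ring_laplacian c) v = \sum_k c 0 k * (v 0 k - v 0 (ord_pred k)) ^+ 2.
Proof.
rewrite /qform /ring_laplacian !mulmxA -[_ *m (incidence R n)^T *m v^T]mulmxA.
rewrite -trmx_mul mxE; apply: eq_bigr => k _.
by rewrite mul_mx_diag !mxE -!mul_incidence !mxE; ring.
Qed.

Lemma ring_laplacian_sym (R : realFieldType) n (c : 'rV[R]_n) :
  (ring_laplacian c)^T = ring_laplacian c.
Proof. by rewrite /ring_laplacian !trmx_mul trmxK tr_diag_mx mulmxA. Qed.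

Lemma ring_laplacian_const (R : realFieldType) n (c : 'rV[R]_n) (a : R) :
  (const_mx a : 'rV[R]_n) *m ring_laplacian c = 0.
Proof.
rewrite /ring_laplacian !mulmxA.
have -> : (const_mx a : 'rV[R]_n) *m incidence R n = 0.
  by apply/rowP => k; rewrite mul_incidence !mxE subrr.
by rewrite !mul0mx.
Qed.

Lemma val_ord_pred n (k : 'I_n.+1) :
  ord_pred k = (if k == 0%N :> nat then n else k.-1) :> nat.
Proof.
rewrite /ord_pred /= addnS [_.+1.-1]/=; case: k => [[|k] /= lek].
  by rewrite modn_small.
by rewrite addSnnS modnDr modn_small // ltnW.
Qed.

(** The ring is connected. *)
Lemma const_of_pred_eq (R : realFieldType) n (v : 'rV[R]_n.+1) :
  (forall k, v 0 k = v 0 (ord_pred k)) -> v = v 0 0 *: const_mx 1.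
Proof.
move=> vpred; apply/rowP => -[k lek]; rewrite !mxE mulr1.
elim: k lek => [|k IHk] lek; first by congr (v 0 _); apply: val_inj.
rewrite vpred -(IHk (ltnW lek)); congr (v 0 _); apply: val_inj.
exact: val_ord_pred.
Qed.

Lemma const_mx1_neq0 (R : realFieldType) n : (const_mx 1 : 'rV[R]_n.+1) != 0.
Proof. by apply/eqP => /rowP /(_ 0) /eqP; rewrite !mxE oner_eq0. Qed.

(** A vector of the kernel annihilates every term of the form, so its
    neighbouring entries agree; and the value of the form at an eigenvector is
    the eigenvalue times a squared norm. *)
Lemma ring_laplacian_stable (R : realFieldType) n (c : 'rV[R]_n.+1) :
  (forall k, 0 < c 0 k) -> stable_matrix (ring_laplacian c).
Proof.
move=> c_gt0.
have term_ge0 (v : 'rV[R]_n.+1) k :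
    0 <= c 0 k * (v 0 k - v 0 (ord_pred k)) ^+ 2.
  by rewrite mulr_ge0 ?sqr_ge0 // ltW.
split.
  have -> : 1%N = \rank (const_mx 1 : 'rV[R]_n.+1).
    by rewrite rank_rV const_mx1_neq0.
  apply/eqmx_rank/andP; split; last first.
    by apply/sub_kermxP; exact: ring_laplacian_const.
  apply/row_subP => i.
  have /sub_kermxP r0 := row_sub i (kermx (ring_laplacian c)).
  set r := row i _ in r0 *.
  rewrite (@const_of_pred_eq _ _ r) ?scalemx_sub // => k.
  have : qform (ring_laplacian c) r = 0 by rewrite /qform r0 mul0mx mxE.
  rewrite qform_ring_laplacian => /(psumr_eq0P (fun k _ => term_ge0 r k)).
  move=> /(_ k isT) /eqP; rewrite mulf_eq0 gt_eqF //= sqrf_eq0 subr_eq0.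
  by move/eqP.
move=> a /eigenvalueP [v va v0] a0; rewrite lt_def a0 /=.
have : 0 <= qform (ring_laplacian c) v.
  by rewrite qform_ring_laplacian sumr_ge0.
have -> : qform (ring_laplacian c) v = a * qform 1%:M v.
  by rewrite /qform va mulmx1 -scalemxAl mxE.
rewrite pmulr_lge0 // lt_def sqnorm_ge0 andbT.
by apply: contra_neq v0; exact: sqnorm_eq0.
Qed.

(** A vector where the form vanishes is in the kernel, which contains the
    constant vectors and has dimension 1. *)
Lemma stable_ring_laplacian_gt0 (R : realType) n (c v : 'rV[R]_n.+1) i j :
  stable_matrix (ring_laplacian c) ->
  v 0 i != v 0 j -> 0 < qform (ring_laplacian c) v.
Proof.
move=> stab vij; have [rank1 _] := stab.
have psd u := stable_matrix_psd u (ring_laplacian_sym c) stab.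
rewrite lt_def psd andbT; apply: contra_neq vij => v0.
have /sub_kermxP v_ker := psd_isotropic (ring_laplacian_sym c) psd v0.
have one_ker : ((const_mx 1 : 'rV[R]_n.+1) <= kermx (ring_laplacian c))%MS.
  by apply/sub_kermxP; exact: ring_laplacian_const.
have ker_one : (kermx (ring_laplacian c) <= (const_mx 1 : 'rV[R]_n.+1))%MS.
  rewrite -(geq_leqif (mxrank_leqif_sup one_ker)) rank1 rank_rV.
  by rewrite const_mx1_neq0.
have /sub_rVP [a ->] := submx_trans v_ker ker_one.
by rewrite !mxE.
Qed.

(** If k < l, the indicator vector of the arc k, ..., l - 1 jumps only across
    the edges k and l, so its form is c_k + c_l. *)
Lemma stable_nonpos_edge_unique (R : realType) n (c : 'rV[R]_n.+1) k l :
  stable_matrix (ring_laplacian c) ->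
  c 0 k <= 0 -> c 0 l <= 0 -> k = l.
Proof.
move=> stab.
wlog lekl : k l / (k <= l)%N => [th ck cl|ck cl].
  by case/orP: (leq_total k l) => [/th|/th eqkl]; [exact|symmetry; exact: eqkl].
apply/eqP; apply: contraT => neqkl.
have ltkl : (k < l)%N by rewrite ltn_neqAle lekl andbT.
pose v : 'rV[R]_n.+1 := \row_i (k <= i < l)%N%:R.
have : 0 < qform (ring_laplacian c) v.
  apply: (@stable_ring_laplacian_gt0 _ _ c v k l) => //.
  by rewrite !mxE leqnn ltkl ltnn andbF oner_eq0.
rewrite ltNge qform_ring_laplacian sumr_le0 // => i _.
have [->|ik] := eqVneq i k; first by rewrite mulr_le0_ge0 ?sqr_ge0.
have [->|il] := eqVneq i l; first by rewrite mulr_le0_ge0 ?sqr_ge0.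
suff -> : v 0 i = v 0 (ord_pred i) by rewrite subrr expr0n mulr0.
rewrite !mxE val_ord_pred; congr (_%:R); congr nat_of_bool.
move: (ltn_ord i) (ltn_ord l) ik il; rewrite -!val_eqE /=.
by case: ifP; lia.
Qed.

(** * The Hessian of the energy *)

(** Reduces a directional derivative to a derivative in one variable; the
    difference quotients are the same. *)
Lemma is_derive_along_line (R : realType) (V W : normedModType R) (f : V -> W)
    (a v : V) (l : W) :
  is_derive (0 : R) 1 (fun t : R => f (t *: v + a)) l -> is_derive a v f l.
Proof.
pose F (t : R) := f (t *: v + a).
have E : (fun h : R => h^-1 *: ((F \o shift 0) (h *: 1) - F 0)) =
    (fun h : R => h^-1 *: ((f \o shift a) (h *: v) - f a)).
  by apply/funext => h; rewrite /F /= scale0r add0r addr0 [h *: 1]mulr1.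
by case=> [df Df]; split; [rewrite /derivable -E|rewrite /derive -E].
Qed.

Lemma is_derive_coord_diff (R : realType) n (g : R -> R) (a v : 'rV[R]_n)
    (j k : 'I_n) :
  derivable g (a 0 k - a 0 j) 1 ->
  is_derive a v (fun th : 'rV[R]_n => g (th 0 k - th 0 j))
    (derive1 g (a 0 k - a 0 j) * (v 0 k - v 0 j)).
Proof.
move=> dg; apply: is_derive_along_line.
pose l (t : R) := t * (v 0 k - v 0 j) + (a 0 k - a 0 j).
have -> : (fun t : R => g ((t *: v + a) 0 k - (t *: v + a) 0 j)) = g \o l.
  by apply/funext => t /=; congr g; rewrite /l !mxE; ring.
have l0 : l 0 = a 0 k - a 0 j by rewrite /l mul0r add0r.
rewrite -l0 in dg *.
apply: (@is_derive1_comp _ g l); first by rewrite derive1E; exact: derivableP.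
have -> : l = (v 0 k - v 0 j) *: (id : R -> R) + cst (a 0 k - a 0 j).
  by apply/funext => t; rewrite /l mulrC.
by apply: is_derive_eq; rewrite addr0 [_ *: _]mulr1.
Qed.

Definition edge_weight (R : realType) n (delta : R -> R) (th : 'rV[R]_n)
    : 'rV[R]_n :=
  \row_k (delta^`(2) (th 0 k - th 0 (ord_pred k))).

Lemma hessian_energy (R : realType) n (delta : R -> R) (th : 'rV[R]_n) :
  (forall x, derivable delta x 1) -> (forall x, derivable (delta^`()) x 1) ->
  hessian (energy delta) th = ring_laplacian (edge_weight delta th).
Proof.
move=> d1 d2.
have D1 j : partial (energy delta) j = fun a : 'rV[R]_n =>
    \sum_(k < n) incidence R n j k * derive1 delta (a 0 k - a 0 (ord_pred k)).
  apply/funext => a; rewrite /partial.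
  have -> : energy delta = \sum_(k < n)
      (fun a : 'rV[R]_n => delta (a 0 k - a 0 (ord_pred k))).
    by apply/funext => b; rewrite fct_sumE.
  rewrite (@derive_val _ _ _ _ _ _ _ (is_derive_sum (fun k =>
    is_derive_coord_diff 'e_j (d1 (a 0 k - a 0 (ord_pred k)))))).
  by apply: eq_bigr => k _; rewrite !mxE /= mulrC.
apply/matrixP => i j; rewrite [LHS]mxE D1 /partial.
have -> : (fun a : 'rV[R]_n =>
    \sum_(k < n) incidence R n j k * derive1 delta (a 0 k - a 0 (ord_pred k))) =
   \sum_(k < n) (incidence R n j k *:
     (fun a : 'rV[R]_n => derive1 delta (a 0 k - a 0 (ord_pred k)))).
  by apply/funext => b; rewrite fct_sumE.
rewrite (@derive_val _ _ _ _ _ _ _ (is_derive_sum (fun k => is_deriveZ _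
    (is_derive_coord_diff 'e_i (d2 (th 0 k - th 0 (ord_pred k))))))).
rewrite /ring_laplacian mxE; apply: eq_bigr => k _.
rewrite mul_mx_diag !mxE /= [LHS]mulrC.
by congr (_ * _); exact: mulrC.
Qed.

(** * The sign of the second derivative of the coupling function *)

Lemma derive1_periodic1 (R : realType) (f : R -> R) :
  (forall x, f (x + 1) = f x) -> forall x, derive1 f (x + 1) = derive1 f x.
Proof.
move=> f1 x; rewrite /derive1.
suff -> : (fun h => h^-1 *: (f (h + (x + 1)) - f (x + 1))) =
    (fun h => h^-1 *: (f (h + x) - f x)) by [].
by apply/funext => h; rewrite addrA !f1.
Qed.

Lemma periodic1_mod1 (R : realType) (f : R -> R) (x y : R) :
  (forall x, f (x + 1) = f x) -> eq_mod1 x y -> f x = f y.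
Proof.
move=> f1.
have f1n n z : f (z + n%:R) = f z.
  by elim: n => [|n IHn]; rewrite ?addr0 // -addn1 natrD addrA f1.
rewrite /eq_mod1 => /intrP [[n|n] xy].
  by rewrite -(subrK y x) xy addrC f1n.
rewrite NegzE mulrNz in xy.
by rewrite -[LHS](f1n n.+1) -(subrK y x) xy addrAC addNr add0r.
Qed.

(** By continuity delta'' is negative at a point of (0, 1/4) and positive at a
    point of (1/4, 1/2), which excludes a nonincreasing delta''. *)
Lemma coupling_deriv2_nondecreasing (R : realType) (delta : R -> R) :
  coupling_function delta ->
  forall x y, 0 < x -> x <= y -> y < 1 / 2 -> delta^`(2) x <= delta^`(2) y.
Proof.
move=> hd; have [//|dec] := coupling_deriv2_monotone hd.
have cont x : {for x, continuous (delta^`(2))}.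
  have := @coupling_smooth _ _ hd 2 x.
  by move/derivable1_diffP/differentiable_continuous.
have [x [x0 x14 dx]] : exists x : R, [/\ 0 < x, x < 1 / 4 & delta^`(2) x < 0].
  have : \forall x \near (0 : R)^'+, [/\ 0 < x, x < 1 / 4 & delta^`(2) x < 0].
    near=> x; split; near: x.
    - exact: nbhs_right_gt.
    - by apply: nbhs_right_lt; lra.
    - apply: (cvgr_lt _ (cvg_at_right_filter (cont _))).
      exact: coupling_deriv2_0.
  by move/filter_ex.
have [y [y14 y12 dy]] : exists y : R,
    [/\ 1 / 4 < y, y < 1 / 2 & 0 < delta^`(2) y].
  have : \forall y \near ((1 / 2) : R)^'-,
      [/\ 1 / 4 < y, y < 1 / 2 & 0 < delta^`(2) y].
    near=> y; split; near: y.
    - by apply: nbhs_left_gt; lra.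
    - exact: nbhs_left_lt.
    - apply: (cvgr_gt _ (cvg_at_left_filter (cont _))).
      exact: coupling_deriv2_half.
  by move/filter_ex.
exfalso; have := dec x y x0 (ltW (lt_trans x14 y14)) y12.
by move/(lt_le_trans (lt_trans dx dy)); rewrite ltxx.
Unshelve. all: by end_near.
Qed.

(** By the mean value theorem delta'' vanishes at some point between eta and
    xi. *)
Lemma coupling_deriv2_le0 (R : realType) (delta : R -> R) (xi eta : R) :
  coupling_function delta -> 0 < eta -> eta < xi -> xi < 1 / 2 ->
  delta^`() xi = delta^`() eta -> delta^`(2) eta <= 0.
Proof.
move=> hd eta0 lt_eta_xi xi12 eqd.
have d2 (x : R) : is_derive x 1 (delta^`()) (delta^`(2) x).
  have dx := @coupling_smooth _ _ hd 1 x.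
  by rewrite /derive1n /= [X in is_derive _ _ _ X]derive1E; apply: derivableP.
have cont : {within `[eta, xi], continuous (delta^`())}.
  by apply: derivable_within_continuous => x _;
    exact: (@coupling_smooth _ _ hd 1).
have [c] := MVT lt_eta_xi (fun x _ => d2 x) cont.
rewrite in_itv /= => /andP [eta_c c_xi] /eqP.
rewrite eqd subrr eq_sym mulf_eq0 subr_eq0 [xi == eta]gt_eqF // orbF => /eqP <-.
apply: (coupling_deriv2_nondecreasing hd) => //; first exact: ltW.
exact: lt_trans xi12.
Qed.

(** * Stability of the equilibria *)

Lemma deriv2_mod1 (R : realType) (delta : R -> R) x y :
  coupling_function delta -> eq_mod1 x y -> delta^`(2) x = delta^`(2) y.
Proof.
move=> hd; apply: periodic1_mod1; do 2!apply: derive1_periodic1.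
exact: coupling_periodic hd.
Qed.

Lemma hessian_coupling (R : realType) n (delta : R -> R) (th : 'rV[R]_n) :
  coupling_function delta ->
  hessian (energy delta) th = ring_laplacian (edge_weight delta th).
Proof.
move=> hd; apply: hessian_energy => x.
  exact: (@coupling_smooth _ _ hd 0).
exact: (@coupling_smooth _ _ hd 1).
Qed.

Lemma edge_weight_ordS (R : realType) n (delta : R -> R) (th : 'rV[R]_n) i :
  edge_weight delta th 0 (ordS i) = delta^`(2) (ring_diff th i).
Proof. by rewrite mxE ordSK. Qed.

Lemma stable_pos_weights (R : realType) n (delta : R -> R) (th : 'rV[R]_n.+1) :
  coupling_function delta -> (forall i, 0 < delta^`(2) (ring_diff th i)) ->
  stable (energy delta) th.
Proof.
move=> hd d2_gt0; rewrite /stable hessian_coupling //.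
apply: ring_laplacian_stable => k.
by rewrite -(ord_predK k) edge_weight_ordS.
Qed.

Lemma stable_nonpos_weight_unique (R : realType) n (delta : R -> R)
    (th : 'rV[R]_n.+1) (A : {set 'I_n.+1}) :
  coupling_function delta -> stable (energy delta) th ->
  (forall i, i \in A -> delta^`(2) (ring_diff th i) <= 0) -> (#|A| <= 1)%N.
Proof.
move=> hd; rewrite /stable hessian_coupling // => stab d2_le0.
rewrite leqNgt; apply/negP => /card_gt1P [i [j [iA jA /eqP]]]; apply.
apply: (can_inj (@ordSK _)); apply: (stable_nonpos_edge_unique stab).
  by rewrite edge_weight_ordS d2_le0.
by rewrite edge_weight_ordS d2_le0.
Qed.

Theorem proposition4p4 (R : realType) (n : nat) (delta : R -> R)
    (hn : (3 <= n)%N) (hdelta : coupling_function delta) :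
  [/\ (* (1) *)
      ~~ odd n ->
        forall theta : 'rV[R]_n,
          Zn_isotropy_equilibrium delta (1 / 2) theta ->
          stable (energy delta) theta,
      (* (2) *)
      forall m : nat, (m.*2 <= n)%N -> m <> 0%N -> m.*2 <> n ->
        forall theta : 'rV[R]_n,
          Zn_isotropy_equilibrium delta (m%:R / n%:R) theta ->
          (stable (energy delta) theta <-> 0 < delta^`(2) (m%:R / n%:R)),
      (* (3) *)
      odd n ->
        forall (theta : 'rV[R]_n) (xi eta : R) (p q : nat),
          trivial_isotropy_equilibrium delta xi eta p q theta ->
          (forall i : 'I_n,
             eq_mod1 (theta 0 i) 0 \/ eq_mod1 (theta 0 i) (1 / 2)) ->
          stable (energy delta) theta ->
          (#|equal_neighbours theta| <= 1)%N
    & (* (4) *)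
      forall (theta : 'rV[R]_n) (xi eta : R) (p q : nat),
        trivial_isotropy_equilibrium delta xi eta p q theta ->
        0 < eta -> xi < 1 / 2 ->
        stable (energy delta) theta ->
        p = n.-1 /\ q = 1%N].
Proof.
case: n hn => [//|n] hn; split.
- move=> _ th [_ diffE]; apply: (stable_pos_weights hdelta) => i.
  by rewrite (deriv2_mod1 hdelta (diffE i)) coupling_deriv2_half.
- move=> m _ _ _ th [_ diffE]; split => [stab|d2_gt0].
    rewrite ltNge; apply/negP => d2_le0.
    suff : (#|[set: 'I_n.+1]%SET| <= 1)%N by rewrite cardsT card_ord; lia.
    apply: (stable_nonpos_weight_unique hdelta stab) => i _.
    by rewrite (deriv2_mod1 hdelta (diffE i)).
  apply: (stable_pos_weights hdelta) => i.
  by rewrite (deriv2_mod1 hdelta (diffE i)).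
- move=> _ th xi eta p q _ _ stab.
  apply: (stable_nonpos_weight_unique hdelta stab) => i; rewrite inE => eq_i.
  suff /(deriv2_mod1 hdelta) -> : eq_mod1 (ring_diff th i) 0.
    exact: ltW (coupling_deriv2_0 hdelta).
  by rewrite /eq_mod1 subr0.
- move=> th xi eta p q ti eta0 xi12 stab.
  have q1 : (q <= 1)%N.
    rewrite -(ti_card_eta ti); apply: (stable_nonpos_weight_unique hdelta stab).
    move=> i; rewrite inE => /(deriv2_mod1 hdelta) ->.
    exact: (coupling_deriv2_le0 hdelta eta0 (ti_eta_lt_xi ti) xi12
              (ti_deriv_eq ti)).
  have := ti_q_gt0 ti; have := ti_pq ti; lia.
Qed.
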